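(* Let $\Bbbk$ be a perfect field, let $m$ be a positive integer, let $g\in\Bbbk[x]$ be a separable polynomial of degree $n$, and let $\lambda_0,\ldots,\lambda_{n-1}$ be the roots of $g$ in the algebraic closure $\overline{\Bbbk}$ of $\Bbbk$. Then for any polynomials $f_0,f_1,\ldots,f_{m-1}\in\Bbbk[x]$ there exist a unique $r\in\Bbbk[x]$ of degree less than $mn$ and unique polynomials $q_0,q_1,\ldots,q_{m-1}\in\Bbbk[x]$ such that $$f_i=r^{(i)}+g\,q_i,\qquad 0\le i\le m-1.$$ This polynomial $r$ is given by $$r(x)=\sum_{j=0}^{n-1}X_j\Lambda_j^{-1}A_j\in\Bbbk[x],$$ where $X_j=\left[L_j(x),\ \frac{(x-\lambda_j)}{1!}L_j(x),\ \ldots,\ \frac{(x-\lambda_j)^{m-1}}{(m-1)!}L_j(x)\right]$ and $A_j=[f_0(\lambda_j),f_1(\lambda_j),\ldots,f_{m-1}(\lambda_j)]^T$. The result is optimal in the following sense: if $m\ge 2$ and $g\in\Bbbk[x]$ of degree $n$ is inseparable (i.e. has a multiple root in $\overline{\Bbbk}$), then it is not true that for all $f_0,\ldots,f_{m-1}\in\Bbbk[x]$ there exist a unique $r\in\Bbbk[x]$ of degree less than $mn$ and unique $q_0,\ldots,q_{m-1}\in\Bbbk[x]$ with $f_i=r^{(i)}+g\,q_i$ for $0\le i\le m-1$.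
   Context: A polynomial is separable if it has no multiple roots in $\overline{\Bbbk}$; $r^{(i)}$ denotes the $i$-th (formal) derivative. For $0\le k\le n-1$, $$L_k(x)=\prod_{\substack{i=0\\ i\ne k}}^{n-1}\frac{(x-\lambda_i)^{m}}{(\lambda_k-\lambda_i)^{m}}\in\overline{\Bbbk}[x],$$ and $\Lambda_k=[l_{ij}]_{0\le i,j\le m-1}\in\overline{\Bbbk}^{m\times m}$ is the lower triangular (invertible) matrix with $l_{ij}=\binom{i}{j}L_k^{(i-j)}(\lambda_k)$ if $j\le i$ and $l_{ij}=0$ if $i<j$.
   Formalization: The existence, uniqueness and formula part is proved under the added assumption that (m-1)! is nonzero in the field (characteristic 0 or at least m); otherwise, for n at least 1, the claim fails, since in characteristic p<m every r has zero p-th derivative and f_p=1 cannot be met. *)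

(* Defs.v *)
From HB Require Import structures.
From mathcomp Require Import all_boot all_order all_algebra.

Set Implicit Arguments.
Unset Strict Implicit.
Unset Printing Implicit Defensive.

Import GRing.Theory.
Local Open Scope ring_scope.

Definition algebraic_closure (K : fieldType) (L : closedFieldType)
    (iota : {rmorphism K -> L}) : Prop :=
  forall x : L, algebraicOver iota x.

Definition has_multiple_root (K L : fieldType) (iota : {rmorphism K -> L})
    (p : {poly K}) : Prop :=
  exists x : L, (1 < mup x (map_poly iota p))%N.

Definition separable_over (K L : fieldType) (iota : {rmorphism K -> L})
    (p : {poly K}) : Prop :=
  ~ has_multiple_root iota p.

(* L is meant to be an algebraic closure of K *)
Definition perfect_field (K L : fieldType) (iota : {rmorphism K -> L}) : Prop :=
  forall p : {poly K}, irreducible_poly p -> separable_over iota p.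

(* (m - 1)! is invertible, that is, the characteristic of K is 0 or at least m.
   The coefficients 1/s! (s < m) of hermite_row below only make sense under
   this condition, and interpolation of r, ..., r^`(m-1) fails without it: if
   0 < p < m in characteristic p, then r^`(p) = 0 for every r. *)
Definition factorials_invertible (K : fieldType) (m : nat) : Prop :=
  (m.-1)`!%:R != 0 :> K.

(* [size r <= m * n] says that the degree of r is less than m * n. *)
Definition interpolates (K : fieldType) (m n : nat) (g : {poly K})
    (f : 'I_m -> {poly K}) (r : {poly K}) (q : 'I_m -> {poly K}) : Prop :=
  (size r <= m * n)%N /\ forall i : 'I_m, f i = r^`(i) + g * q i.

(* The finite functions make the uniqueness of the q_i a Leibniz equality. *)
Definition uniquely_interpolable (K : fieldType) (m n : nat) (g : {poly K})
    (f : 'I_m -> {poly K}) : Prop :=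
  exists! rq : {poly K} * {ffun 'I_m -> {poly K}},
    interpolates n g f rq.1 rq.2.

Definition enumerates_roots (L : fieldType) (n : nat) (lambda : 'I_n -> L)
    (p : {poly L}) : Prop :=
  injective lambda /\ forall x : L, root p x = (x \in codom lambda).

Section Hermite.

Variables (L : fieldType) (m n : nat) (lambda : 'I_n -> L).

Definition hermite_basis (k : 'I_n) : {poly L} :=
  \prod_(i < n | i != k)
    ((lambda k - lambda i) ^- m *: ('X - (lambda i)%:P) ^+ m).

Definition hermite_matrix (k : 'I_n) : 'M[L]_m :=
  \matrix_(i < m, j < m)
    (if (j <= i)%N
     then 'C(i, j)%:R * ((hermite_basis k)^`(i - j)).[lambda k]
     else 0).

Definition hermite_row (k : 'I_n) : 'rV[{poly L}]_m :=
  \row_(s < m)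
    ((s`!)%:R^-1 *: (('X - (lambda k)%:P) ^+ s * hermite_basis k)).

Definition hermite_values (f : 'I_m -> {poly L}) (k : 'I_n) : 'cV[L]_m :=
  \col_(i < m) (f i).[lambda k].

Definition hermite_interpolant (f : 'I_m -> {poly L}) : {poly L} :=
  \sum_(k < n)
    (hermite_row k
       *m map_mx polyC (invmx (hermite_matrix k) *m hermite_values f k)) 0 0.

Lemma hermite_basis_node k :
  injective lambda -> (hermite_basis k).[lambda k] = 1.
Proof.
move=> inj; rewrite horner_prod big1 // => i neq_ik.
rewrite hornerZ horner_exp hornerXsubC mulVf // expf_neq0 // subr_eq0.
by apply: contraNneq neq_ik => /inj ->.
Qed.

(* invmx is a total function; here it is applied to an invertible matrix. *)
Lemma hermite_matrix_unit k : injective lambda -> hermite_matrix k \in unitmx.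
Proof.
move=> inj; rewrite unitmxE det_trig.
  rewrite big1 ?unitr1 // => i _.
  by rewrite mxE leqnn subnn binn derivn0 mul1r hermite_basis_node.
by apply/is_trig_mxP => i j lt_ij; rewrite mxE leqNgt lt_ij.
Qed.

End Hermite.

(* Main.v *)
Require Import Defs.
From mathcomp Require Import all_boot all_order all_algebra.
From mathcomp Require Import zify ring.

Set Implicit Arguments.
Unset Strict Implicit.
Unset Printing Implicit Defensive.

Import GRing.Theory.
Local Open Scope ring_scope.

(** If g is coprime to g', then (g^k h)^(k) = k! g'^k h modulo g, with k! g'^k
    invertible modulo g.  Hence the derivatives can be prescribed one after the
    other, correcting r by a multiple g^k h with deg h < deg g at stage k; and,
    conversely, if g divides r, r', ..., r^(m-1) then g^m divides r, which gives
    uniqueness below degree mn.  No descent from the algebraic closure is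
    needed: existence and uniqueness are proved over the base field, and the
    explicit formula follows from uniqueness over the closure. *)

Lemma mup_gt1 (F : fieldType) (p : {poly F}) (x : F) :
  p != 0 -> (1 < mup x p)%N = root p x && root p^`() x.
Proof.
move=> nz_p; rewrite mup_geq //; apply/idP/andP => [/dvdpP[q ->]|[]].
  rewrite expr2 !derivM derivXsubC.
  by rewrite /root !hornerE /= addrK subrr !(mulr0, addr0) eqxx; split.
case/factor_theorem=> q ->; rewrite derivM derivXsubC mulr1.
rewrite /root !hornerE /= subrr mulr0 add0r => /factor_theorem[q1 ->].
by rewrite -mulrA -expr2 dvdp_mulIr.
Qed.

(** For [k < m], [k!] divides [(m-1)!], the quotient being a binomial coefficient times a
    factorial. *)
Lemma fact_natr_neq0 (R : nzRingType) (m k : nat) :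
  (m.-1)`!%:R != 0 :> R -> (k < m)%N -> k`!%:R != 0 :> R.
Proof.
move=> + lt_km; apply: contra_neq => k0.
have le_km : (k <= m.-1)%N by case: m lt_km.
by rewrite -(bin_fact le_km) mulnCA natrM k0 mul0r.
Qed.

(** Coprimality can be tested after extension to [L], where it means having no common root; a common
    root of [g] and its derivative is a multiple root. *)
Lemma separable_coprimep (K : fieldType) (L : closedFieldType)
    (iota : {rmorphism K -> L}) (g : {poly K}) :
  g != 0 -> separable_over iota g -> coprimep g g^`().
Proof.
move=> nz_g sep; rewrite -(coprimep_map iota).
apply/Pdiv.ClosedField.coprimepP => x rx; apply/negP => r'x; apply: sep.
by exists x; rewrite mup_gt1 ?map_poly_eq0 // rx /root deriv_map.
Qed.

(** * Derivatives modulo [g] *)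

Section DerivativesModulo.

Variables (F : fieldType) (g : {poly F}).

Lemma derivn_exp_mul (k : nat) (h : {poly F}) :
  exists u, (g ^+ k * h)^`(k) = k`!%:R *: (g^`() ^+ k * h) + g * u.
Proof.
elim: k h => [|k IHk] h.
  by exists 0; rewrite !expr0 !mul1r mulr0 addr0 scale1r.
(* One derivative is taken first: it leaves [g ^+ k] times a new cofactor, to which the induction
   hypothesis, general in [h], applies. *)
have -> : (g ^+ k.+1 * h)^`(k.+1) =
    (g ^+ k * (k.+1%:R *: (g^`() * h) + g * h^`()))^`(k).
  rewrite derivSn derivM deriv_exp /= -scaler_nat; congr derivn.
  by rewrite exprS -!mul_polyC; ring.
have [u ->] := IHk (k.+1%:R *: (g^`() * h) + g * h^`()).
exists (k`!%:R *: (g^`() ^+ k * h^`()) + u).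
by rewrite exprSr factS natrM -!mul_polyC polyCM; ring.
Qed.

(** Absorb [g ^+ (k - i)] into the cofactor: in [derivn_exp_mul] at order [i], the main term then
    keeps a factor [g]. *)
Lemma dvdp_derivn_exp_mul (i k : nat) (h : {poly F}) :
  (i < k)%N -> g %| (g ^+ k * h)^`(i).
Proof.
move=> lt_ik; rewrite -(subnKC (ltnW lt_ik)) exprD -mulrA.
have [u ->] := derivn_exp_mul i (g ^+ (k - i) * h).
rewrite dvdp_addl ?dvdp_mulIl // -mul_polyC.
by apply/dvdp_mull/dvdp_mull/dvdp_mulr/dvdp_exp; rewrite ?subn_gt0.
Qed.

Hypothesis sep_g : coprimep g g^`().

Lemma dvdp_exp_derivn (m : nat) (p : {poly F}) :
    (m.-1)`!%:R != 0 :> F -> (forall i, (i < m)%N -> g %| p^`(i)) ->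
  g ^+ m %| p.
Proof.
move=> m1 dvd_g; suff: forall k, (k <= m)%N -> g ^+ k %| p by apply.
elim=> [|k IHk] lt_km; first by rewrite expr0 dvd1p.
have /dvdpP[h def_p] := IHk (ltnW lt_km).
have [u def_pk] := derivn_exp_mul k h.
(* Modulo [g], the [k]-th derivative of [p] is a unit times [h], so [g] divides [h] and the exponent
   grows by one. *)
have := dvd_g k lt_km; rewrite def_p mulrC def_pk dvdp_addl ?dvdp_mulIl //.
rewrite dvdpZr ?(fact_natr_neq0 m1 lt_km) // Gauss_dvdpr ?coprimep_expr //.
by rewrite exprSr; apply: dvdp_mul.
Qed.

Lemma derivn_dvdp_eq0 (m n : nat) (p : {poly F}) :
    size g = n.+1 -> (m.-1)`!%:R != 0 :> F -> (size p <= m * n)%N ->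
    (forall i, (i < m)%N -> g %| p^`(i)) ->
  p = 0.
Proof.
move=> sz_g m1 sz_p dvd_g; apply: contraTeq sz_p => nz_p.
have := dvdp_leq nz_p (dvdp_exp_derivn m1 dvd_g).
have := size_exp g m.
have: g ^+ m != 0 by rewrite expf_neq0 -?size_poly_gt0 ?sz_g.
by rewrite sz_g -size_poly_gt0 -ltnNge mulnC /=; case: size => //= s _ ->.
Qed.

Lemma coprimep_solve (a c : {poly F}) :
    g != 0 -> coprimep g a ->
  exists2 h : {poly F}, (size h < size g)%N & g %| c - a * h.
Proof.
move=> nz_g /Bezout_eq1_coprimepP[[u v] /= uv1].
(* By Bezout, [v] is an inverse of [a] modulo [g]. *)
exists ((v * c) %% g); first by rewrite ltn_modp.
have -> : c - a * ((v * c) %% g) = g * (u * c + a * ((v * c) %/ g)).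
  rewrite -{1}[c]mul1r -uv1 {1}mulrDl -[v * a * c]mulrAC {1}(divp_eq (v * c) g).
  ring.
exact: dvdp_mulIl.
Qed.

Lemma derivn_interpolation (m n : nat) (f : nat -> {poly F}) :
    size g = n.+1 -> (m.-1)`!%:R != 0 :> F ->
  exists2 r : {poly F}, (size r <= m * n)%N &
    forall i, (i < m)%N -> g %| f i - r^`(i).
Proof.
move=> sz_g m1; have nz_g: g != 0 by rewrite -size_poly_gt0 sz_g.
suff: forall k, (k <= m)%N -> exists2 r : {poly F},
    (size r <= k * n)%N & forall i, (i < k)%N -> g %| f i - r^`(i) by apply.
elim=> [|k IHk] lt_km; first by exists 0; rewrite ?size_poly0.
have [r sz_r dvd_r] := IHk (ltnW lt_km).
have cop : coprimep g (k`!%:R *: g^`() ^+ k).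
  by rewrite coprimepZr ?(fact_natr_neq0 m1 lt_km) // coprimep_expr.
have [h sz_h dvd_h] := coprimep_solve (f k - r^`(k)) nz_g cop.
exists (r + g ^+ k * h) => [|i].
  rewrite (leq_trans (size_polyD _ _)) // geq_max mulSn.
  rewrite (leq_trans sz_r) ?leq_addl //=.
  rewrite (leq_trans (size_polyMleq _ _)) //.
  (* The correction has degree less than [k * n + n], since [h] has degree less than [n]. *)
  have := size_poly_exp_leq g k; move: sz_h; rewrite sz_g /= mulnC; lia.
rewrite ltnS leq_eqVlt derivnD opprD addrA => /predU1P[->|lt_ik].
  have [u ->] := derivn_exp_mul k h.
  by rewrite scalerAl opprD addrA dvdp_addr ?dvdpNr ?dvdp_mulIl.
by rewrite dvdp_addr ?dvd_r // dvdpNr dvdp_derivn_exp_mul.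
Qed.

End DerivativesModulo.

(** * Hermite interpolation at the nodes *)

Lemma horner_derivn_XsubC (R : comNzRingType) (a : R) (i : nat) p :
  (('X - a%:P) * p)^`(i).[a] = i%:R * p^`(i.-1).[a].
Proof.
have -> : (('X - a%:P) * p)^`(i) = ('X - a%:P) * p^`(i) + p^`(i.-1) *+ i.
  elim: i => [|i IHi]; first by rewrite mulr0n addr0.
  rewrite derivnS IHi derivD derivM derivXsubC mul1r derivMn -derivnS /=.
  case: i {IHi} => [|i]; first by rewrite mulr0n addr0 addrC.
  by rewrite [in RHS]mulrS [RHS]addrCA addrA.
by rewrite !hornerE /= hornerMn subrr mul0r add0r mulr_natl.
Qed.

(** For [i < s] the falling factorial vanishes, so the truncated [i - s] is harmless. *)
Lemma horner_derivn_XsubC_exp (R : comNzRingType) (a : R) (s i : nat) p :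
  (('X - a%:P) ^+ s * p)^`(i).[a] = (i ^_ s)%:R * p^`(i - s).[a].
Proof.
elim: s i => [|s IHs] i; first by rewrite !mul1r subn0.
rewrite exprS -mulrA horner_derivn_XsubC IHs mulrA -natrM -ffactnS.
by rewrite -subn1 -subnDA.
Qed.

Section HermiteInterpolant.

Variables (L : fieldType) (m n : nat) (lambda : 'I_n -> L).

Lemma size_hermite_basis (k : 'I_n) :
  (size (hermite_basis m lambda k) <= (m * n.-1).+1)%N.
Proof.
rewrite (leq_trans (size_poly_prod_leq _ _)) // leq_subLR.
rewrite (_ : (m * n.-1).+1 = (\sum_(i < n | i != k) m).+1); last first.
  by rewrite sum_nat_const cardC1 card_ord mulnC.
rewrite addnS ltnS -sum1_card -big_split leq_sum // => i _.
by rewrite (leq_trans (size_scale_leq _ _)) // size_exp_XsubC.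
Qed.

Lemma dvdp_hermite_basis (j k : 'I_n) :
  j != k -> ('X - (lambda j)%:P) ^+ m %| hermite_basis m lambda k.
Proof.
move=> neq_jk; rewrite /hermite_basis (bigD1 j) //= -mul_polyC.
exact/dvdp_mulr/dvdp_mull.
Qed.

Lemma hermite_interpolantE (f : 'I_m -> {poly L}) :
  hermite_interpolant lambda f =
  \sum_(k < n) \sum_(s < m)
    ((invmx (hermite_matrix m lambda k) *m hermite_values lambda f k) s 0
       / s`!%:R) *: (('X - (lambda k)%:P) ^+ s * hermite_basis m lambda k).
Proof.
apply: eq_bigr => k _; rewrite mxE; apply: eq_bigr => s _.
by rewrite !mxE mulrC mul_polyC scalerA.
Qed.

Lemma size_hermite_interpolant (f : 'I_m -> {poly L}) :
  (size (hermite_interpolant lambda f) <= m * n)%N.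
Proof.
rewrite hermite_interpolantE; apply/(leq_trans (size_sum _ _ _)).
apply/bigmax_leqP => k _; apply/(leq_trans (size_sum _ _ _)).
apply/bigmax_leqP => s _; rewrite (leq_trans (size_scale_leq _ _)) //.
rewrite (leq_trans (size_polyMleq _ _)) // size_exp_XsubC /=.
have n_gt0 : (0 < n)%N by apply: leq_trans (ltn_ord k).
have := size_hermite_basis k; have := ltn_ord s.
by rewrite -[in (m * n)%N](prednK n_gt0) mulnS; move: (m * _)%N (size _); lia.
Qed.

Lemma horner_derivn_hermite_interpolant (f : 'I_m -> {poly L}) i k :
    injective lambda -> (m.-1)`!%:R != 0 :> L ->
  (hermite_interpolant lambda f)^`(i : 'I_m).[lambda k] = (f i).[lambda k].
Proof.
move=> inj_l m1; rewrite hermite_interpolantE.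
rewrite linear_sum horner_sum (bigD1 k) //= [X in _ + X]big1 => [|j neq_jk].
  set c := invmx _ *m _; rewrite linear_sum horner_sum addr0.
  (* Dividing the falling factorial by [s!] gives the binomial coefficient of the matrix entry, so
     block [k] contributes its matrix times the inverse of that matrix times the values. *)
  transitivity ((hermite_matrix m lambda k *m c) i 0).
    rewrite mxE; apply: eq_bigr => s _.
    rewrite linearZ hornerZ horner_derivn_XsubC_exp.
    rewrite [hermite_matrix _ _ _ _ _]mxE -bin_ffact natrM /=.
    have [le_si|lt_is] := leqP s i; last by rewrite bin_small // !mul0r mulr0.
    by field; apply: fact_natr_neq0 m1 (ltn_ord s).
  by rewrite mulmxA mulmxV ?hermite_matrix_unit // mul1mx mxE.
rewrite linear_sum horner_sum big1 // => s _; rewrite linearZ hornerZ.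
have neq_kj: k != j by rewrite eq_sym.
(* Every other block vanishes to order [m] at node [k], and [i < m]. *)
have /dvdpP[w ->] := dvdp_hermite_basis neq_kj.
rewrite mulrA [_ * _ ^+ m]mulrC.
by rewrite horner_derivn_XsubC_exp ffact_small // mul0r mulr0.
Qed.

End HermiteInterpolant.

Theorem theorem3p1 (K : fieldType) (L : closedFieldType)
    (iota : {rmorphism K -> L}) (m n : nat) (g : {poly K}) :
  algebraic_closure iota ->
  perfect_field iota ->
  (0 < m)%N ->
  size g = n.+1 ->
  (separable_over iota g ->
   factorials_invertible K m ->
   forall f : 'I_m -> {poly K},
     uniquely_interpolable n g f /\
     (forall (r : {poly K}) (q : 'I_m -> {poly K}),
        interpolates n g f r q ->
        forall lambda : 'I_n -> L,
          enumerates_roots lambda (map_poly iota g) ->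
          map_poly iota r =
            hermite_interpolant lambda (fun i => map_poly iota (f i))))
  /\
  ((2 <= m)%N ->
   has_multiple_root iota g ->
   ~ (forall f : 'I_m -> {poly K}, uniquely_interpolable n g f)).
Proof.
move=> _ _ _ sz_g; have nz_g: g != 0 by rewrite -size_poly_gt0 sz_g.
split=> [sep m1 f | m_gt1 [x]]; last first.
  rewrite mup_gt1 ?map_poly_eq0 // deriv_map => /andP[/rootP gx /rootP g'x].
  (* With f_0 = 0 and f_1 = 1, r = - g q_0 would have a zero derivative at the
     multiple root x, whereas f_1(x) = 1. *)
  move/(_ (fun i => i%:R)) => [[r q] [[_ /= fE] _]].
  have f0E : 0 = r + g * q (Ordinal (ltnW m_gt1)).
    exact: fE (Ordinal (ltnW m_gt1)).
  have f1E : 1 = r^`() + g * q (Ordinal m_gt1).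
    exact: fE (Ordinal m_gt1).
  move/esym/eqP: f0E; rewrite addr_eq0 => /eqP def_r.
  move/(congr1 (fun p => (map_poly iota p).[x])): f1E; rewrite def_r.
  rewrite derivN derivM !(rmorphD, rmorphN, rmorphM, rmorph1) /= !hornerE.
  by rewrite gx g'x !mul0r !addr0 oppr0 => /eqP; rewrite oner_eq0.
have cop := separable_coprimep nz_g sep.
split=> [|r q [sz_r fE] lambda [inj_l rootsE]].
  (* Extension of [f] by zero to all indices, as [derivn_interpolation] takes a family over
     [nat]. *)
  pose f' j := if insub j is Some i then f i else 0.
  have [r sz_r dvd_r] := derivn_interpolation cop f' sz_g m1.
  have fE (i : 'I_m) : f i = r^`(i) + g * ((f i - r^`(i)) %/ g).
    have := dvd_r i (ltn_ord i); rewrite /f' valK => dvd_i.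
    by rewrite mulrC divpK // addrC subrK.
  exists (r, [ffun i : 'I_m => (f i - r^`(i)) %/ g]).
  split=> [|[r1 q1] [/= sz_r1 fE1]].
    by split=> //= i; rewrite ffunE.
  have eq_r : r1 = r.
    apply/eqP; rewrite -subr_eq0; apply/eqP.
    apply: (derivn_dvdp_eq0 cop sz_g m1) => [|i lt_im].
      by rewrite (leq_trans (size_polyD _ _)) // size_polyN geq_max sz_r1.
    have := fE1 (Ordinal lt_im); rewrite (fE (Ordinal lt_im)) /=.
    rewrite derivnB => eq_f.
    suff -> : r1^`(i) - r^`(i) =
        g * ((f (Ordinal lt_im) - r^`(i)) %/ g - q1 (Ordinal lt_im)).
      exact: dvdp_mulIl.
    rewrite mulrBr; apply/eqP.
    by rewrite subr_eq addrAC eq_sym subr_eq addrC eq_f.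
  congr (_, _) => //; apply/ffunP => i; rewrite ffunE.
  by apply/(mulfI nz_g)/(addrI r^`(i)); rewrite -fE -{1}eq_r -fE1.
have cop_L : coprimep (map_poly iota g) (map_poly iota g)^`().
  by rewrite deriv_map coprimep_map.
have m1_L : (m.-1)`!%:R != 0 :> L by rewrite -(rmorph_nat iota) fmorph_eq0.
have sz_gL : size (map_poly iota g) = n.+1 by rewrite size_map_poly.
(* The [n] distinct nodes exhaust the degree of [g], so divisibility by [g] over [L] amounts to
   vanishing at every node. *)
have g_prod : map_poly iota g =
    lead_coef (map_poly iota g) *: \prod_(z <- codom lambda) ('X - z%:P).
  apply: all_roots_prod_XsubC; first by rewrite size_codom card_ord.
    by apply/allP => x; rewrite -rootsE.
  by rewrite uniq_rootsE; apply/injectiveP.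
(* Uniqueness over [L] is applied to the difference of the two sides. *)
apply/eqP; rewrite -subr_eq0; apply/eqP.
apply: (derivn_dvdp_eq0 cop_L sz_gL m1_L) => [|i lt_im].
  rewrite (leq_trans (size_polyD _ _)) // size_polyN geq_max size_map_poly sz_r.
  exact: size_hermite_interpolant.
rewrite g_prod dvdpZl ?lead_coef_eq0 ?map_poly_eq0 //.
apply: uniq_roots_dvdp; last by rewrite uniq_rootsE; apply/injectiveP.
apply/allP => _ /codomP[k ->]; rewrite /root derivnB hornerD hornerN.
have := horner_derivn_hermite_interpolant (fun j => map_poly iota (f j))
  (Ordinal lt_im) k inj_l m1_L.
rewrite /= => ->; rewrite (fE (Ordinal lt_im)) /=.
rewrite rmorphD rmorphM /= hornerD hornerM.
have /rootP -> : root (map_poly iota g) (lambda k) by rewrite rootsE codom_f.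
by rewrite mul0r addr0 derivn_map subrr.
Qed.
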